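(* Let $P \subset \mathbb{R}^2$ be a ($2$-dimensional) lattice polygon and let $\Delta$ be a dense and foldable triangulation of $P$, with its triangles colored black and white accordingly. Then for every fixed $\tau \in \{X, Y, XY\}$, the signature $\sigma(\Delta)$ equals the absolute value of the difference between the number of black boundary edges of type $\tau$ and the number of white boundary edges of type $\tau$ of $\Delta$.
   Context: A lattice polygon is a $2$-dimensional convex hull of finitely many points of $\mathbb{Z}^2$. A triangulation $\Delta$ of $P$ is dense if the vertices of $\Delta$ are precisely the points of $P \cap \mathbb{Z}^2$. It is foldable if its dual graph (nodes are the triangles of $\Delta$; two triangles are adjacent if they share an edge) is bipartite; in this case the triangles are colored black and white so that any two triangles sharing an edge have different colors (this coloring is unique up to exchanging the two colors). The normalized area of a lattice polygon is twice its Euclidean area; it is an integer. The signature $\sigma(\Delta)$ is the absolute value of the difference between the number of black triangles of odd normalized area and the number of white triangles of odd normalized area in $\Delta$. A boundary edge of $\Delta$ is an edge of $\Delta$ contained in the boundary of $P$; it receives the color (black or white) of the unique triangle of $\Delta$ containing it. For $p, q \in \mathbb{Z}^2$, the segment $[p,q] = \operatorname{conv}\{p,q\}$ is of type $X$ if the first coordinate of $p-q$ is odd and the second is even, of type $Y$ if the second coordinate of $p-q$ is odd and the first is even, and of type $XY$ if both coordinates of $p-q$ are odd. *)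

(* Defs.v *)
From HB Require Import structures.
From mathcomp Require Export all_boot all_order all_algebra finmap.
From mathcomp Require Export all_classical all_reals all_analysis.

Set Implicit Arguments.
Unset Strict Implicit.
Unset Printing Implicit Defensive.

Import Order.TTheory GRing.Theory Num.Theory.
Import numFieldNormedType.Exports.

Local Open Scope classical_set_scope.
Local Open Scope ring_scope.
Local Open Scope fset_scope.

Notation lattice_point := (int * int)%type.

(* A lattice simplex (triangle, edge) is given by its set of vertices; the
   corresponding subset of the plane is [lattice_hull]. *)
Notation simplex := {fset lattice_point}.

Section Plane.
Context {R : realType}.

Definition plane_of (p : lattice_point) : R * R := (p.1%:~R, p.2%:~R).

Definition convex_hull (A : set (R * R)) : set (R * R) :=
  smallest (@convex_set R (R * R)%type) A.

Definition lattice_hull (S : simplex) : set (R * R) :=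
  convex_hull (plane_of @` [set` S]).

(* A planar set has dimension 2 when it contains three affinely independent
   points, i.e. when [b - a] and [c - a] have nonzero determinant. *)
Definition two_dimensional (A : set (R * R)) : Prop :=
  exists a b c : R * R, [/\ A a, A b, A c &
    (b.1 - a.1) * (c.2 - a.2) - (b.2 - a.2) * (c.1 - a.1) != 0].

Definition lattice_polygon (P : set (R * R)) : Prop :=
  (exists S : simplex, P = lattice_hull S) /\ two_dimensional P.

Definition is_triangle (T : simplex) : Prop :=
  #|` T| = 3 /\ two_dimensional (lattice_hull T).

(* The area is the two-dimensional Lebesgue measure. *)
Definition normalized_area (A : set (R * R)) : \bar R :=
  (2%:E * (@lebesgue_measure R \x @lebesgue_measure R) A)%E.

Definition odd_area (T : simplex) : Prop :=
  exists n : nat, odd n /\ normalized_area (lattice_hull T) = n%:R%:E.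

Definition boundary (P : set (R * R)) : set (R * R) := (closure P `\` interior P)%classic.

(* A triangulation is given by its set of triangles: these cover [P], and any
   two of them meet in a common face, namely the hull of a (possibly empty)
   common set of vertices. *)
Definition triangulation (P : set (R * R)) (D : {fset simplex}) : Prop :=
  [/\ {in D, forall T, is_triangle T},
      P = (\bigcup_(T in [set` D]) lattice_hull T)%classic &
      {in D &, forall T U, exists F : simplex,
         [/\ F `<=` T, F `<=` U &
             (lattice_hull T `&` lattice_hull U)%classic = lattice_hull F]}].

Definition vertices (D : {fset simplex}) : {fset lattice_point} :=
  \bigcup_(T <- D) T.

Definition dense_triangulation (P : set (R * R)) (D : {fset simplex}) : Prop :=
  forall p : lattice_point, p \in vertices D <-> P (plane_of p).

End Plane.

Definition edges_of (T : simplex) : {fset simplex} :=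
  [fset e in fpowerset T | #|` e| == 2%N].

Definition edges (D : {fset simplex}) : {fset simplex} :=
  \bigcup_(T <- D) edges_of T.

Definition dual_adjacent (T U : simplex) : Prop :=
  T <> U /\ exists e : simplex, e \in edges_of T /\ e \in edges_of U.

(* A proper 2-coloring of the dual graph, [true] being black and [false]
   white; [D] is foldable when there is one. Only the values on [D] matter. *)
Definition folding (D : {fset simplex}) (black : simplex -> bool) : Prop :=
  {in D &, forall T U, dual_adjacent T U -> black T <> black U}.

Definition foldable (D : {fset simplex}) : Prop :=
  exists black : simplex -> bool, folding D black.

Definition absdiff (m n : nat) : nat := `|m%:Z - n%:Z|%N.

Definition odd_triangles (R : realType) (D : {fset simplex})
    (black : simplex -> bool) (color : bool) : {fset simplex} :=
  [fset T in D | (black T == color) && `[< @odd_area R T >]].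

(* Exchanging the two colors does not change the signature. *)
Definition signature (R : realType) (D : {fset simplex})
    (black : simplex -> bool) : nat :=
  absdiff #|` odd_triangles R D black true| #|` odd_triangles R D black false|.

Inductive edge_type := TypeX | TypeY | TypeXY.

Definition odd_int (z : int) : bool := odd `|z|%N.

Definition segment_type (tau : edge_type) (p q : lattice_point) : bool :=
  match tau with
  | TypeX => odd_int (p.1 - q.1) && ~~ odd_int (p.2 - q.2)
  | TypeY => ~~ odd_int (p.1 - q.1) && odd_int (p.2 - q.2)
  | TypeXY => odd_int (p.1 - q.1) && odd_int (p.2 - q.2)
  end.

Definition has_type (tau : edge_type) (e : simplex) : Prop :=
  exists p q : lattice_point, e = [fset p; q] /\ segment_type tau p q.

Definition boundary_edges (R : realType) (P : set (R * R))
    (D : {fset simplex}) : {fset simplex} :=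
  [fset e in edges D | `[< lattice_hull e `<=` boundary P >]%classic].

Definition edge_has_color (D : {fset simplex}) (black : simplex -> bool)
    (color : bool) (e : simplex) : Prop :=
  exists T : simplex, [/\ T \in D, e \in edges_of T & black T = color].

Definition typed_boundary_edges (R : realType) (P : set (R * R))
    (D : {fset simplex}) (black : simplex -> bool) (color : bool)
    (tau : edge_type) : {fset simplex} :=
  [fset e in boundary_edges P D |
     `[< edge_has_color D black color e >] && `[< has_type tau e >]].

(* Main.v *)
Require Import Defs.
From mathcomp Require Import ring lra zify measurable_realfun.

(** A dense triangulation only contains triangles of odd normalized area, and
    each of them has exactly one edge of every type. Indeed, an edge whose two
    coordinate differences are both even has a lattice midpoint; by density
    this midpoint is a vertex of some triangle, and since two triangles meet in
    a common face it would be a vertex of every triangle containing it, which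
    is absurd ([dense_odd_difference]). So modulo 2 the three edge vectors of a
    triangle are nonzero and sum to zero: they are the three distinct nonzero
    vectors of the plane over the field with two elements, one of each type
    ([one_edge_per_type]), and their determinant is odd ([odd_det]). As the
    normalized area of a triangle is the absolute value of that determinant
    ([area_tri]), it is odd ([dense_odd_area]).

    Give a black triangle the sign 1 and a white one the sign -1. Summing the
    signs over all triangles gives the difference that defines the signature.
    Because every triangle has exactly one edge of type [tau], this is also the
    sum over all pairs of a triangle and one of its edges of type [tau].
    Grouped by edges, the pairs at an edge inside the polygon cancel, since such
    an edge lies in exactly two triangles and these have opposite colors, while
    an edge in the boundary lies in exactly one triangle and contributes the
    sign of its color ([signed_triangles_at_edge]). The two differences are thus
    equal even before taking absolute values ([signed_count_eq]).

    The geometric input is how triangles meet along an edge. Two triangles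
    sharing an edge lie on opposite sides of it, for otherwise they would
    overlap near its midpoint and not meet in a common face
    ([shared_edge_opposite]); hence at most two triangles share an edge
    ([at_most_two_triangles]), and if two do, the midpoint is interior to the
    polygon ([shared_edge_not_boundary]). Conversely, if some point of an edge
    of a triangle is interior to the polygon, then points just across the edge
    are covered by another triangle, which must contain the edge
    ([inner_edge_shared]). *)

Set Implicit Arguments.
Unset Strict Implicit.
Unset Printing Implicit Defensive.

Import Order.TTheory GRing.Theory Num.Theory.
Import numFieldNormedType.Exports.

Local Open Scope classical_set_scope.
Local Open Scope ring_scope.

(** * Determinants and convex combinations *)

(** Twice the signed area of the triangle [a b c]: the sign gives the side of
    the line [a b] on which [c] lies, and for lattice points it is an integer. *)
Definition det3 (K : pzRingType) (a b c : K * K) : K :=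
  (b.1 - a.1) * (c.2 - a.2) - (b.2 - a.2) * (c.1 - a.1).

(** The operation [conv] of the vector space of pairs, written in coordinates
    so that it can be fed to ring identities. *)
Definition mix (K : pzRingType) (t : K) (x y : K * K) : K * K :=
  (t * x.1 + (1 - t) * y.1, t * x.2 + (1 - t) * y.2).

Section Det3.
Context {K : comNzRingType}.
Implicit Types (a b c z : (K * K)%type) (t : K).

Lemma det3_rot a b c : det3 b c a = det3 a b c.
Proof. by rewrite /det3; ring. Qed.

Lemma det3_rot2 a b c : det3 c a b = det3 a b c.
Proof. by rewrite /det3; ring. Qed.

Lemma det3_mix a b t x y :
  det3 a b (mix t x y) = t * det3 a b x + (1 - t) * det3 a b y.
Proof. by rewrite /det3 /mix /=; ring. Qed.

Lemma det3_sum a b c z : det3 z b c + det3 a z c + det3 a b z = det3 a b c.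
Proof. by rewrite /det3; ring. Qed.

Lemma det3_aab a b : det3 a a b = 0.
Proof. by rewrite /det3; ring. Qed.

Lemma det3_aba a b : det3 a b a = 0.
Proof. by rewrite /det3; ring. Qed.

Lemma det3_abb a b : det3 a b b = 0.
Proof. by rewrite /det3; ring. Qed.

End Det3.

(** * A lattice triangle as an intersection of half-planes *)
Section Hull.
Context {R : realType}.
Implicit Types (a b c p q z : R * R).

Lemma convex_set_mix (A : set (R * R)) : @convex_set R (R * R)%type A <->
  (forall x y t, A x -> A y -> 0 <= t <= 1 -> A (mix t x y)).
Proof.
split=> [cA x y t Ax Ay t01|cA x y l].
  have := cA x y (Itv01 (proj1 (andP t01)) (proj2 (andP t01))).
  by rewrite !inE; apply.
rewrite !inE => Ax Ay.
by have := cA x y l%:num Ax Ay; apply; rewrite ge0 le1.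
Qed.

Lemma hull_convex (A : set (R * R)) x y t :
  convex_hull A x -> convex_hull A y -> 0 <= t <= 1 ->
  convex_hull A (mix t x y).
Proof.
move=> Ax Ay t01 C [cC AC].
by apply: (proj1 (convex_set_mix C)) => //; [exact: Ax|exact: Ay].
Qed.

Lemma lattice_hull_sub (S : simplex) (C : set (R * R)) :
  (forall x y t, C x -> C y -> 0 <= t <= 1 -> C (mix t x y)) ->
  (forall v, v \in S -> C (plane_of v)) -> lattice_hull S `<=` C.
Proof.
move=> cC SC; apply: smallest_sub; first exact/convex_set_mix.
by move=> _ [v /= vS <-]; exact: SC.
Qed.

Lemma lattice_hull_vertex (S : simplex) v :
  v \in S -> @lattice_hull R S (plane_of v).
Proof. by move=> vS; apply: sub_gen_smallest; exists v. Qed.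

Lemma lattice_hullS (S U : simplex) :
  (S `<=` U)%fset -> @lattice_hull R S `<=` lattice_hull U.
Proof.
move=> /fsubsetP SU; apply: lattice_hull_sub => [x y t|v /SU]; first exact: hull_convex.
exact: lattice_hull_vertex.
Qed.

Lemma det3_plane (a b c : lattice_point) :
  det3 (plane_of a) (plane_of b) (plane_of c) = (det3 a b c)%:~R :> R.
Proof. by rewrite /det3 /plane_of /= !rmorphB !rmorphM !rmorphB. Qed.

(** The three determinants, divided by [det3 a b c], are the barycentric
    coordinates of [z]. Multiplying by [det3 a b c] instead has the same signs
    and treats both orientations of the triangle at once. *)
Definition tri a b c : set (R * R) :=
  [set z | [/\ 0 <= det3 z b c * det3 a b c, 0 <= det3 a z c * det3 a b c &
               0 <= det3 a b z * det3 a b c]].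

Lemma bary_sum a b c z : det3 a b c != 0 ->
  z = (det3 z b c / det3 a b c * a.1 + det3 a z c / det3 a b c * b.1 +
       det3 a b z / det3 a b c * c.1,
       det3 z b c / det3 a b c * a.2 + det3 a z c / det3 a b c * b.2 +
       det3 a b z / det3 a b c * c.2).
Proof.
move=> d0; have split_quot d u v w x y t : u / d * x + v / d * y + w / d * t =
    (u * x + v * y + w * t) / d :> R by ring.
rewrite !split_quot [LHS]surjective_pairing.
by congr pair; apply: (canRL (mulfK d0)); rewrite /det3; ring.
Qed.

Lemma mix3 (H : set (R * R)) a b c (r s t : R) :
  (forall x y t, H x -> H y -> 0 <= t <= 1 -> H (mix t x y)) ->
  H a -> H b -> H c -> 0 <= r -> 0 <= s -> 0 <= t -> r + s + t = 1 ->
  H (r * a.1 + s * b.1 + t * c.1, r * a.2 + s * b.2 + t * c.2).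
Proof.
move=> cH Ha Hb Hc r0 s0 t0 rst.
have [r1|r1] := eqVneq r 1.
  have -> : s = 0 by lra.
  have -> : t = 0 by lra.
  by rewrite r1 !mul1r !mul0r !addr0 -surjective_pairing.
have u0 : 0 < 1 - r by rewrite subr_gt0 lt_neqAle r1 /=; lra.
have uN0 : 1 - r != 0 by rewrite gt_eqF.
have tE : t = (1 - r) - s by lra.
have Hbc : H (mix (s / (1 - r)) b c).
  by apply: cH => //; rewrite divr_ge0 ?(ltW u0) //= ler_pdivrMr // mul1r; lra.
have := cH _ _ r Ha Hbc; rewrite r0 /= => /(_ _)/wrap[]; first lra.
by congr H; rewrite /mix /= tE; congr pair; field.
Qed.

Lemma mix_ge0 (t x y d : R) : 0 <= t <= 1 -> 0 <= x * d -> 0 <= y * d ->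
  0 <= (t * x + (1 - t) * y) * d.
Proof.
move=> /andP[t0 t1] x0 y0; rewrite mulrDl -!mulrA.
by rewrite addr_ge0 // mulr_ge0 // subr_ge0.
Qed.

Lemma tri_mix a b c x y t :
  tri a b c x -> tri a b c y -> 0 <= t <= 1 -> tri a b c (mix t x y).
Proof.
move=> [x1 x2 x3] [y1 y2 y3] t01; split.
- move: x1 y1; rewrite -!(det3_rot _ b c) det3_mix; exact: mix_ge0.
- move: x2 y2; rewrite -!(det3_rot2 _ _ c) det3_mix; exact: mix_ge0.
- by rewrite det3_mix; exact: mix_ge0.
Qed.

(** The half-plane description is convex and contains the vertices, hence the
    hull; conversely a point with nonnegative barycentric coordinates is a convex
    combination of the vertices. *)
Lemma lattice_hull_triangle (a b c : lattice_point) : det3 a b c != 0 ->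
  lattice_hull [fset a; b; c]%fset = tri (plane_of a) (plane_of b) (plane_of c).
Proof.
move=> d0.
have : det3 (plane_of a) (plane_of b) (plane_of c) != 0 :> R.
  by rewrite det3_plane intr_eq0.
have [Ha Hb Hc] : [/\ @lattice_hull R [fset a; b; c]%fset (plane_of a),
  @lattice_hull R [fset a; b; c]%fset (plane_of b) &
  @lattice_hull R [fset a; b; c]%fset (plane_of c)].
  by split; apply: lattice_hull_vertex; rewrite !inE eqxx ?orbT.
have sub (C : set (R * R)) :
    (forall x y t, C x -> C y -> 0 <= t <= 1 -> C (mix t x y)) ->
    C (plane_of a) -> C (plane_of b) -> C (plane_of c) ->
    lattice_hull [fset a; b; c]%fset `<=` C.
  by move=> cC ? ? ?; apply: lattice_hull_sub => // v; rewrite !inE -orbA => /or3P[] /eqP->.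
move: Ha Hb Hc sub; set H := lattice_hull _.
have cH x y t : H x -> H y -> 0 <= t <= 1 -> H (mix t x y) by exact: hull_convex.
move: H cH (plane_of a) (plane_of b) (plane_of c).
move=> H cH {d0} {}a {}b {}c Ha Hb Hc sub d0.
have dd : 0 < det3 a b c * det3 a b c by rewrite -expr2 exprn_even_gt0.
rewrite eqEsubset; split.
  apply: sub; first exact: tri_mix.
  - by split; rewrite ?det3_aab ?det3_aba ?mul0r ?(ltW dd).
  - by split; rewrite ?det3_aab ?det3_abb ?mul0r ?(ltW dd).
  - by split; rewrite ?det3_aba ?det3_abb ?mul0r ?(ltW dd).
move=> z [za zb zc].
have lge x : 0 <= x * det3 a b c -> 0 <= x / det3 a b c.
  move=> x0; have -> : x / det3 a b c = x * det3 a b c * (det3 a b c * det3 a b c)^-1.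
    by move: d0; move: (det3 _ _ _) => d d0; field.
  by apply: mulr_ge0; rewrite // invr_ge0 ltW.
rewrite (bary_sum z d0); apply: mix3 => //; try exact: lge.
by rewrite -!mulrDl det3_sum divff.
Qed.

End Hull.

(** * Edges and faces of triangles *)
Lemma edges_ofP (T e : simplex) : e \in edges_of T <->
  exists p q, [/\ p != q, p \in T, q \in T & e = [fset p; q]%fset].
Proof.
rewrite /edges_of !inE /= fpowersetE; split.
  move=> /andP[/fsubsetP eT /eqP e2].
  have /fset0Pn[p pe] : e != fset0 by rewrite -cardfs_gt0 e2.
  have := cardfsD1 p e; rewrite pe e2 => -[/esym/eqP/cardfs1P[q qE]].
  have := fset11 q; rewrite -qE !inE => /andP[qp qe].
  exists p, q; split; [by rewrite eq_sym|exact: eT|exact: eT|].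
  by rewrite -qE fsetD1K.
move=> [p [q [pq pT qT ->]]]; rewrite cardfs2 pq andbT.
by apply/fsubsetP=> x; rewrite !inE => /orP[] /eqP->.
Qed.

Section Faces.
Context {R : realType}.
Implicit Types (a b c p q z : R * R).

(** If three points of [A] all lie on the line [p q], their determinant is killed
    by both coordinates of [q - p], one of which is nonzero. *)
Lemma collinear_flat p q (A : set (R * R)) : p <> q ->
  A `<=` [set z | det3 p q z = 0] -> ~ two_dimensional A.
Proof.
move=> pq AL [a [b [c [/AL /= a0 /AL /= b0 /AL /= c0]]]]; apply/negP; rewrite negbK.
have e1 : (q.1 - p.1) * det3 a b c = 0.
  transitivity ((b.1 - a.1) * (det3 p q c - det3 p q a) -
                (c.1 - a.1) * (det3 p q b - det3 p q a)).
    by rewrite /det3; ring.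
  by rewrite a0 b0 c0 !subrr !mulr0 subrr.
have e2 : (q.2 - p.2) * det3 a b c = 0.
  transitivity ((b.2 - a.2) * (det3 p q c - det3 p q a) -
                (c.2 - a.2) * (det3 p q b - det3 p q a)).
    by rewrite /det3; ring.
  by rewrite a0 b0 c0 !subrr !mulr0 subrr.
change (det3 a b c == 0); apply: contraT => d0.
move/eqP: e1; move/eqP: e2; rewrite !mulf_eq0 (negbTE d0) !orbF !subr_eq0.
move=> /eqP e2 /eqP e1.
by case: pq; rewrite (surjective_pairing p) (surjective_pairing q) e1 e2.
Qed.

Lemma plane_of_inj : injective (@plane_of R).
Proof.
move=> [a1 a2] [b1 b2] [/eqP] h1 /eqP h2.
by move: h1 h2; rewrite !eqr_int => /eqP-> /eqP->.
Qed.

Lemma third_vertex (T : simplex) (p q : lattice_point) :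
  @is_triangle R T -> p != q -> p \in T -> q \in T ->
  exists2 c, T = [fset p; q; c]%fset & det3 p q c != 0.
Proof.
move=> [T3 T2] pq pT qT.
have : #|` T `\ p `\ q|%fset = 1%N.
  have := cardfsD1 p T; rewrite pT T3 => -[].
  by have := cardfsD1 q (T `\ p)%fset; rewrite !inE eq_sym pq qT /= => -> -[].
move=> /eqP/cardfs1P [c cE].
have TE : T = [fset p; q; c]%fset.
  apply/fsetP=> x; move/fsetP/(_ x): cE; rewrite !inE.
  by case: eqVneq => [->|_]; case: eqVneq => [->|_]; rewrite ?pT ?qT //= => ->.
exists c => //; apply/eqP => d0; move: T2; apply: (@collinear_flat (plane_of p) (plane_of q)).
  by move=> /plane_of_inj /eqP; rewrite (negbTE pq).
rewrite TE; apply: lattice_hull_sub.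
  by move=> x y t /= x0 y0 _; rewrite det3_mix x0 y0 !mulr0 addr0.
move=> v; rewrite !inE -orbA => /or3P[] /eqP-> /=.
- exact: det3_aba.
- exact: det3_abb.
- by rewrite det3_plane d0.
Qed.

(** A face that omits [c] lies on the line through the other two vertices; so a
    point of the face off that line forces [c] to be a vertex of the face. *)
Lemma face_vertex (F : simplex) (p q c : lattice_point) z :
  (F `<=` [fset p; q; c])%fset -> lattice_hull F z ->
  det3 (plane_of p) (plane_of q) z != 0 -> c \in F.
Proof.
move=> /fsubsetP FT Fz; apply: contraNT => cF; apply/eqP.
move: z Fz; apply: lattice_hull_sub => [x y t /= x0 y0 _|v vF].
  by rewrite det3_mix x0 y0 !mulr0 addr0.
have := FT v vF; rewrite !inE -orbA => /or3P[] /eqP vE /=.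
- by rewrite vE det3_aba.
- by rewrite vE det3_abb.
- by rewrite -vE vF in cF.
Qed.

Lemma continuous_det3r p q : continuous (fun z => det3 p q z).
Proof.
move=> z; rewrite /det3; apply: cvgB; apply: cvgM; try exact: cvg_cst.
  by apply: cvgB; [exact: cvg_snd|exact: cvg_cst].
by apply: cvgB; [exact: cvg_fst|exact: cvg_cst].
Qed.

Lemma continuous_det3l p q : continuous (fun z => det3 z p q).
Proof.
rewrite (_ : (fun z => det3 z p q) = (fun z => det3 p q z)).
  exact: continuous_det3r.
by apply/funext => z; rewrite (det3_rot z p q).
Qed.

Lemma continuous_det3m p q : continuous (fun z => det3 p z q).
Proof.
rewrite (_ : (fun z => det3 p z q) = (fun z => det3 q p z)).
  exact: continuous_det3r.
by apply/funext => z; rewrite (det3_rot q p z).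
Qed.

Lemma tri_closed a b c : closed (tri a b c).
Proof.
have cl (f : R * R -> R) : continuous f -> closed [set z | 0 <= f z * det3 a b c].
  move=> cf; apply: (@closed_comp _ _ (fun z => f z * det3 a b c) [set x | 0 <= x]);
    last exact: closed_ge.
  by move=> z _; apply: cvgM; [exact: cf|exact: cvg_cst].
rewrite (_ : tri a b c = [set z | 0 <= det3 z b c * det3 a b c] `&`
  ([set z | 0 <= det3 a z c * det3 a b c] `&` [set z | 0 <= det3 a b z * det3 a b c])).
  apply: closedI; last apply: closedI; apply: cl.
  - exact: continuous_det3l.
  - exact: continuous_det3m.
  - exact: continuous_det3r.
by rewrite eqEsubset; split=> z => [[]|[? []]].
Qed.

Definition midpoint p q := mix 2^-1 p q.

(** At the midpoint of the side [p q] the barycentric coordinates of [p] and [q]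
    are both one half, so near it only the constraint of the side [p q] itself
    matters. *)
Lemma near_midpoint_tri p q c : det3 p q c != 0 ->
  \forall z \near midpoint p q, 0 <= det3 p q z * det3 p q c -> tri p q c z.
Proof.
move=> d0.
have dd : 0 < det3 p q c * det3 p q c by rewrite -expr2 exprn_even_gt0.
have near_pos (f : R * R -> R) : continuous f -> 0 < f (midpoint p q) * det3 p q c ->
    \forall z \near midpoint p q, 0 < f z * det3 p q c.
  move=> cf f0.
  have h : f z * det3 p q c @[z --> midpoint p q] --> f (midpoint p q) * det3 p q c.
    by apply: cvgM; [exact: cf|exact: cvg_cst].
  by have := @cvgr_gt _ _ _ _ _ _ h 0 f0; apply.
have m1 : det3 (midpoint p q) q c = det3 p q c / 2.
  by rewrite /midpoint /mix /det3 /=; field.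
have m2 : det3 p (midpoint p q) c = det3 p q c / 2.
  by rewrite /midpoint /mix /det3 /=; field.
near=> z => z0; split=> //; apply: ltW; near: z; apply: near_pos.
- exact: continuous_det3l.
- by rewrite m1 mulrAC divr_gt0.
- exact: continuous_det3m.
- by rewrite m2 mulrAC divr_gt0.
Unshelve. all: end_near. Qed.

(** Nearby points are reached along half-lines, because [det3] is affine in [t]
    there and its sign can be read off ([det3_shift]). *)
Lemma near_path (A : set (R * R)) z (n : R * R) : nbhs z A ->
  \forall t \near 0^'+, A (z.1 + t * n.1, z.2 + t * n.2).
Proof.
move=> zA.
have c : (fun t : R => (z.1 + t * n.1, z.2 + t * n.2)) @ 0 --> z.
  rewrite [X in _ --> X](_ : z = (z.1 + 0 * n.1, z.2 + 0 * n.2)); last first.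
    by rewrite !mul0r !addr0 -surjective_pairing.
  apply: (@cvg_pair _ _ _ _ (nbhs _) (nbhs _)); (apply: cvgD; first exact: cvg_cst);
    (apply: cvgM; [exact: cvg_id|exact: cvg_cst]).
by apply: cvg_within; exact: c.
Qed.

End Faces.

(** * How triangles of a triangulation meet along an edge *)
Section Triangulation.
Context {R : realType}.
Variables (P : set (R * R)) (D : {fset simplex}).
Hypothesis hD : triangulation P D.
Local Notation pl := (@plane_of R).

Lemma triangle_vertices T : @is_triangle R T ->
  exists a b c, T = [fset a; b; c]%fset /\ det3 a b c != 0.
Proof.
move=> TT; have [T3 _] := TT.
have /fset0Pn[a aT] : T != fset0 by rewrite -cardfs_gt0 T3.
have : #|` T `\ a|%fset = 2 by have := cardfsD1 a T; rewrite aT T3 => -[].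
move=> T2; have /fset0Pn[b] : (T `\ a)%fset != fset0 by rewrite -cardfs_gt0 T2.
rewrite !inE => /andP[ba bT]; exists a, b.
have ab : a != b by rewrite eq_sym.
by have [c] := third_vertex TT ab aT bT; exists c.
Qed.

Lemma det3_plane_neq0 (a b c : lattice_point) :
  det3 a b c != 0 -> det3 (pl a) (pl b) (pl c) != 0.
Proof. by rewrite det3_plane intr_eq0. Qed.

Lemma triangle_hull_sub T : T \in D -> lattice_hull T `<=` P.
Proof. by case: hD => _ -> _ TD z Tz; exists T. Qed.

Lemma det3_midpoint (p q : R * R) : det3 p q (midpoint p q) = 0.
Proof. by rewrite det3_mix det3_aba det3_abb !mulr0 addr0. Qed.

Lemma det3_shift (p q z : R * R) (t : R) (n : R * R) :
  det3 p q (z.1 + t * n.1, z.2 + t * n.2) =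
  det3 p q z + t * ((q.1 - p.1) * n.2 - (q.2 - p.2) * n.1).
Proof. by rewrite /det3 /=; ring. Qed.

(** If [c] and [d] were on the same side of [p q], a point slightly off the
    midpoint of [p q] on that side would lie in both triangles, hence in their
    common face; as it is off the line [p q], this face would contain [c], so [c]
    would be [d]. *)
Lemma shared_edge_opposite T U (p q c d : lattice_point) :
  T \in D -> U \in D -> T <> U ->
  T = [fset p; q; c]%fset -> U = [fset p; q; d]%fset ->
  det3 p q c != 0 -> det3 p q d != 0 ->
  det3 (pl p) (pl q) (pl c) * det3 (pl p) (pl q) (pl d) < 0.
Proof.
move=> TD UD TU TE UE c0 d0; have [_ _ /(_ T U TD UD) [F [FT FU TUF]]] := hD.
have c0' := det3_plane_neq0 c0; have d0' := det3_plane_neq0 d0.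
rewrite ltNge; apply/negP => cd.
(* Going from the midpoint [m] in the direction [c - p] moves to the side of [c]. *)
pose n := ((pl c).1 - (pl p).1, (pl c).2 - (pl p).2).
pose m := midpoint (pl p) (pl q).
have [t [t0 Tt Ut]] : exists t : R, [/\ 0 < t,
    (0 <= det3 (pl p) (pl q) (m.1 + t * n.1, m.2 + t * n.2) * det3 (pl p) (pl q) (pl c) ->
     tri (pl p) (pl q) (pl c) (m.1 + t * n.1, m.2 + t * n.2)) &
    (0 <= det3 (pl p) (pl q) (m.1 + t * n.1, m.2 + t * n.2) * det3 (pl p) (pl q) (pl d) ->
     tri (pl p) (pl q) (pl d) (m.1 + t * n.1, m.2 + t * n.2))].
  apply: (@filter_ex _ (0 : R)^'+); near=> t; split.
  - by near: t; exact: nbhs_right_gt.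
  - by near: t; apply: near_path n (near_midpoint_tri c0').
  - by near: t; apply: near_path n (near_midpoint_tri d0').
move: Tt Ut; set z := (_, _).
have zE : det3 (pl p) (pl q) z = t * det3 (pl p) (pl q) (pl c).
  by rewrite det3_shift det3_midpoint add0r.
rewrite zE -!mulrA => /(_ _)/wrap[];
  first by apply: mulr_ge0; [exact: ltW | rewrite -expr2 sqr_ge0].
move=> Tz /(_ _)/wrap[]; first by apply: mulr_ge0; [exact: ltW | exact: cd].
move=> Uz.
have Fz : lattice_hull F z.
  by rewrite -TUF TE UE; split; rewrite lattice_hull_triangle.
have cF : c \in F.
  apply: (@face_vertex _ F p q c z _ Fz); first by rewrite -TE; exact: FT.
  by rewrite zE mulf_neq0 // gt_eqF.
move/fsubsetP: FU => /(_ c cF); rewrite UE !inE -orbA => /or3P[] /eqP cE.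
- by move: c0; rewrite cE det3_aba eqxx.
- by move: c0; rewrite cE det3_abb eqxx.
- by apply: TU; rewrite TE UE cE.
Unshelve. all: end_near. Qed.

(** The two triangles lie on opposite sides of the edge, so together they cover a
    neighborhood of its midpoint. *)
Lemma shared_edge_not_boundary T U (e : simplex) :
  T \in D -> U \in D -> T <> U -> e \in edges_of T -> e \in edges_of U ->
  ~ (lattice_hull e `<=` boundary P).
Proof.
move=> TD UD TU /edges_ofP[p [q [pq pT qT eE]]] /edges_ofP[p' [q' [_ pU qU eE']]] eB.
have [pU' qU'] : p \in U /\ q \in U.
  have sub x : x \in e -> x \in U by rewrite eE' !inE => /orP[] /eqP->.
  by split; apply: sub; rewrite eE !inE eqxx ?orbT.
have [Tri _ _] := hD.
have [c TE c0] := third_vertex (Tri T TD) pq pT qT.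
have [d UE d0] := third_vertex (Tri U UD) pq pU' qU'.
have cd := shared_edge_opposite TD UD TU TE UE c0 d0.
have c0' := det3_plane_neq0 c0; have d0' := det3_plane_neq0 d0.
have [_] : boundary P (midpoint (pl p) (pl q)).
  apply: eB; apply: hull_convex; last lra;
    by apply: lattice_hull_vertex; rewrite eE !inE eqxx ?orbT.
apply; rewrite /interior /=; near=> z.
have [z0|z0] := leP 0 (det3 (pl p) (pl q) z * det3 (pl p) (pl q) (pl c)).
  apply: (triangle_hull_sub TD); rewrite TE lattice_hull_triangle //; move: z0; near: z.
  exact: near_midpoint_tri.
apply: (triangle_hull_sub UD); rewrite UE lattice_hull_triangle //.
have : 0 <= det3 (pl p) (pl q) z * det3 (pl p) (pl q) (pl d).
  move: z0 cd; move: (det3 _ _ _) (det3 _ _ _) (det3 _ _ _) => x y w xy yw.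
  by have [y0|y0] := leP 0 y; nra.
near: z; exact: near_midpoint_tri.
Unshelve. all: end_near. Qed.

(** A point of the edge interior to [P] may be moved along the edge to a point [y]
    that is still interior to [P] but is no endpoint. The triangles not
    containing [y] form a closed set, so points just across the edge from [T] lie
    in a triangle [U] that contains [y]; the common face of [T] and [U] contains
    [y], a point between [p] and [q], hence both [p] and [q]. *)
Lemma inner_edge_shared T (e : simplex) : T \in D -> e \in edges_of T ->
  ~ (lattice_hull e `<=` boundary P) ->
  exists U, [/\ U \in D, U <> T & e \in edges_of U].
Proof.
move=> TD eT /existsNP[x /not_implyP[ex xB]].
have /edges_ofP[p [q [pq pT qT eE]]] := eT.
have [Tri PE Dface] := hD.
have [c TE c0] := third_vertex (Tri T TD) pq pT qT.
have dd : 0 < det3 (pl p) (pl q) (pl c) * det3 (pl p) (pl q) (pl c).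
  by rewrite -expr2 exprn_even_gt0 //= det3_plane_neq0.
have xT : tri (pl p) (pl q) (pl c) x.
  rewrite -lattice_hull_triangle // -TE; apply: lattice_hullS ex.
  by apply/fsubsetP => v; rewrite eE !inE => /orP[] /eqP->.
have xint : P° x.
  apply: contrapT => xI; apply: xB; split=> //; apply: subset_closure.
  by apply: (triangle_hull_sub TD); rewrite TE lattice_hull_triangle.
have x0 : det3 (pl p) (pl q) x = 0.
  move: x ex {xB xT xint}; apply: lattice_hull_sub => [x y t /= x0 y0 _|v].
    by rewrite det3_mix x0 y0 !mulr0 addr0.
  by rewrite eE !inE => /orP[] /eqP-> /=; rewrite ?det3_aba ?det3_abb.
(* [y] is found by moving from [x] slightly towards the midpoint of the edge. *)
have [y [yP yp yq y0]] : exists y, [/\ P° y,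
    0 < det3 y (pl q) (pl c) * det3 (pl p) (pl q) (pl c),
    0 < det3 (pl p) y (pl c) * det3 (pl p) (pl q) (pl c) &
    det3 (pl p) (pl q) y = 0].
  pose m := midpoint (pl p) (pl q).
  pose n := (m.1 - x.1, m.2 - x.2).
  have [t [t0 t1 tP]] : exists t : R, [/\ 0 < t, t < 1 &
      P° (x.1 + t * n.1, x.2 + t * n.2)].
    apply: (@filter_ex _ (0 : R)^'+); near=> t; split.
    - by near: t; exact: nbhs_right_gt.
    - by near: t; exact: nbhs_right_lt.
    - by near: t; apply: near_path; apply: nbhs_interior.
  exists (x.1 + t * n.1, x.2 + t * n.2); have [xp xq _] := xT; split=> //.
  - rewrite [ltRHS](_ : _ = (1 - t) * (det3 x (pl q) (pl c) * det3 (pl p) (pl q) (pl c)) +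
      t * (det3 (pl p) (pl q) (pl c) * det3 (pl p) (pl q) (pl c)) / 2); last first.
      by rewrite /n /m /midpoint /mix /det3 /=; field.
    by apply: ltr_wpDl; [rewrite mulr_ge0 //; lra | rewrite divr_gt0 // mulr_gt0].
  - rewrite [ltRHS](_ : _ = (1 - t) * (det3 (pl p) x (pl c) * det3 (pl p) (pl q) (pl c)) +
      t * (det3 (pl p) (pl q) (pl c) * det3 (pl p) (pl q) (pl c)) / 2); last first.
      by rewrite /n /m /midpoint /mix /det3 /=; field.
    by apply: ltr_wpDl; [rewrite mulr_ge0 //; lra | rewrite divr_gt0 // mulr_gt0].
  - rewrite [LHS](_ : _ = (1 - t) * det3 (pl p) (pl q) x + t * det3 (pl p) (pl q) m).
      by rewrite x0 det3_midpoint !mulr0 addr0.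
    by rewrite /n /det3 /=; ring.
pose far := \bigcup_(U in [set` D] `&` [set U | ~ lattice_hull U y]) @lattice_hull R U.
have far_closed : closed far.
  apply: closed_bigcup => [|U [UD _]].
    by apply: sub_finite_set (finite_fset D) => U [].
  have [a [b [d [-> d0]]]] := triangle_vertices (Tri U UD).
  rewrite lattice_hull_triangle //; exact: tri_closed.
have fary : ~ far y by move=> [U [_ yU]].
(* The direction [y - c] leads across the edge, out of [T]. *)
pose n := (y.1 - (pl c).1, y.2 - (pl c).2).
have [t [t0 tP tF]] : exists t : R, [/\ 0 < t,
      P (y.1 + t * n.1, y.2 + t * n.2) & (~` far) (y.1 + t * n.1, y.2 + t * n.2)].
  apply: (@filter_ex _ (0 : R)^'+); near=> t; split.
  - by near: t; exact: nbhs_right_gt.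
  - by near: t; apply: near_path.
  - near: t; apply: near_path; apply: open_nbhs_nbhs; split=> //.
    exact: closed_openC.
move: tP tF; set z := (_, _) => tP tF.
have zT : ~ lattice_hull T z.
  rewrite TE lattice_hull_triangle // => -[_ _].
  rewrite det3_shift y0 add0r.
  rewrite [leRHS](_ : _ = t * (det3 (pl p) (pl q) y * det3 (pl p) (pl q) (pl c) -
     det3 (pl p) (pl q) (pl c) * det3 (pl p) (pl q) (pl c))); last first.
    by rewrite /n /det3 /=; ring.
  by rewrite y0 mul0r sub0r mulrN oppr_ge0 leNgt mulr_gt0.
move: tP; rewrite [P in P z]PE => -[U /= UD Uz].
have Uy : lattice_hull U y by apply: contrapT => yU; apply: tF; exists U.
have UT : U <> T by move=> UT; apply: zT; rewrite -UT.
exists U; split=> //; apply/edges_ofP; exists p, q.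
have [F [FT FU TUF]] := Dface T U TD UD.
have Fy : lattice_hull F y.
  rewrite -TUF; split=> //; rewrite TE lattice_hull_triangle //.
  by split; rewrite ?(ltW yp) ?(ltW yq) // y0 mul0r.
split=> //; apply: (fsubsetP FU).
- apply: (@face_vertex _ F q c p y _ Fy).
    apply: (fsubset_trans FT); rewrite TE; apply/fsubsetP => v.
    by rewrite !inE -!orbA => /or3P[]->; rewrite ?orbT.
  by rewrite det3_rot; apply: contraTneq yp => ->; rewrite mul0r ltxx.
- apply: (@face_vertex _ F p c q y _ Fy).
    apply: (fsubset_trans FT); rewrite TE; apply/fsubsetP => v.
    by rewrite !inE -!orbA => /or3P[]->; rewrite ?orbT.
  apply: contraTneq yq.
  have -> : det3 (pl p) y (pl c) = - det3 (pl p) (pl c) y by rewrite /det3; ring.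
  by move=> ->; rewrite oppr0 mul0r ltxx.
Unshelve. all: end_near. Qed.

End Triangulation.

(** * Area of a triangle *)
Section Area.
Context {R : realType}.
Implicit Types (a b c z : R * R).
Local Notation mu := (@lebesgue_measure R).

(** A vertical section of a triangle is cut out by two of its sides, at heights
    [l1] and [l2]; the factor [d] is the orientation of the triangle, which
    decides which of them is the upper one. *)
Lemma measure_strip (l1 l2 d k : R) : d != 0 -> 0 <= k -> l2 - l1 = d * k ->
  mu [set y | 0 <= (y - l1) * d /\ 0 <= (l2 - y) * d] = (`|d| * k)%:E.
Proof.
move=> d0 k0 lE; case: (ltgtP d 0) d0 => // [d0|d0] _.
- rewrite (_ : mkset _ = `[l2, l1]%classic); last first.
    apply/seteqP; split=> y /=; rewrite in_itv /= !nmulr_lge0 // !subr_le0.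
      by move=> [-> ->].
    by move=> /andP[-> ->].
  have l21 : l2 <= l1 by rewrite -subr_le0 lE nmulr_rle0.
  rewrite lebesgue_measure_itv /= lte_fin ltr0_norm //.
  case: ltgtP l21 => // [_ _|e _]; first by rewrite -EFinB mulNr -lE opprB.
  by rewrite mulNr -lE e subrr oppr0.
- rewrite (_ : mkset _ = `[l1, l2]%classic); last first.
    apply/seteqP; split=> y /=; rewrite in_itv /= !pmulr_lge0 // !subr_ge0.
      by move=> [-> ->].
    by move=> /andP[-> ->].
  have l21 : l1 <= l2 by rewrite -subr_ge0 lE pmulr_rge0.
  rewrite lebesgue_measure_itv /= lte_fin gtr0_norm //.
  case: ltgtP l21 => // [_ _|e _]; first by rewrite -EFinB -lE.
  by rewrite -lE e subrr.
Qed.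

Lemma det3_baryx a b c z : det3 z b c * a.1 + det3 a z c * b.1 + det3 a b z * c.1 =
  det3 a b c * z.1.
Proof. by rewrite /det3; ring. Qed.

Lemma tri_leftmost a b c z (x : R) : det3 a b c != 0 ->
  x <= a.1 -> x <= b.1 -> x <= c.1 ->
  tri a b c z -> x <= z.1.
Proof.
move=> d0 xa xb xc [za zb zc].
have dd : 0 < det3 a b c * det3 a b c by rewrite -expr2 exprn_even_gt0.
rewrite -(ler_pM2l dd) -mulrA -[leRHS]mulrA -det3_baryx -(det3_sum a b c z).
move: za zb zc; rewrite -(det3_sum a b c z).
move: (det3 z b c) (det3 a z c) (det3 a b z) => u v w u0 v0 w0.
rewrite -subr_ge0.
rewrite [leRHS](_ : _ = u * (u + v + w) * (a.1 - x) + v * (u + v + w) * (b.1 - x) +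
  w * (u + v + w) * (c.1 - x)); last by ring.
by rewrite !addr_ge0 // mulr_ge0 // subr_ge0.
Qed.

Lemma tri_rightmost a b c z (x : R) : det3 a b c != 0 ->
  a.1 <= x -> b.1 <= x -> c.1 <= x ->
  tri a b c z -> z.1 <= x.
Proof.
move=> d0 xa xb xc [za zb zc].
have dd : 0 < det3 a b c * det3 a b c by rewrite -expr2 exprn_even_gt0.
rewrite -(ler_pM2l dd) -mulrA -[leRHS]mulrA -det3_baryx -(det3_sum a b c z).
move: za zb zc; rewrite -(det3_sum a b c z).
move: (det3 z b c) (det3 a z c) (det3 a b z) => u v w u0 v0 w0.
rewrite -subr_ge0.
rewrite [leRHS](_ : _ = u * (u + v + w) * (x - a.1) + v * (u + v + w) * (x - b.1) +
  w * (u + v + w) * (x - c.1)); last by ring.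
by rewrite !addr_ge0 // mulr_ge0 // subr_ge0.
Qed.

(** Left of the middle vertex [b] the section runs between the sides [a b] and
    [a c]; the constraint of the third side follows from the other two. *)
Lemma measure_left_section a b c (x : R) : det3 a b c != 0 ->
  a.1 < b.1 -> b.1 <= c.1 -> a.1 <= x <= b.1 ->
  mu (xsection (tri a b c) x) =
  (`|det3 a b c| * ((x - a.1) / ((b.1 - a.1) * (c.1 - a.1))))%:E.
Proof.
move=> d0 ab bc /andP[ax xb].
have ac : a.1 < c.1 by exact: lt_le_trans bc.
have ab0 : 0 < b.1 - a.1 by rewrite subr_gt0.
have ac0 : 0 < c.1 - a.1 by rewrite subr_gt0.
have abN := lt0r_neq0 ab0; have acN := lt0r_neq0 ac0.
pose l1 := a.2 + (b.2 - a.2) / (b.1 - a.1) * (x - a.1).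
pose l2 := a.2 + (c.2 - a.2) / (c.1 - a.1) * (x - a.1).
rewrite -(@measure_strip l1 l2) //; last 2 first.
- by rewrite divr_ge0 ?mulr_ge0 ?subr_ge0 // ltW.
- by rewrite /l1 /l2 /det3; field; rewrite abN acN.
congr (mu _); apply/seteqP.
have zE y : det3 a b (x, y) = (b.1 - a.1) * (y - l1) by rewrite /det3 /l1 /=; field.
have yE y : det3 a (x, y) c = (c.1 - a.1) * (l2 - y) by rewrite /det3 /l2 /=; field.
split=> y; rewrite /xsection /= inE.
  by move=> [_]; rewrite zE yE -!mulrA (pmulr_rge0 _ ab0) (pmulr_rge0 _ ac0).
move=> [y1 y2].
have w0 : 0 <= det3 a b (x, y) * det3 a b c by rewrite zE -mulrA pmulr_rge0.
split=> //; last by rewrite yE -mulrA pmulr_rge0.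
rewrite -(pmulr_rge0 _ ab0).
rewrite [leRHS](_ : _ = det3 a b c ^+ 2 * (b.1 - x) +
   (det3 a b (x, y) * det3 a b c) * (c.1 - b.1)); last by rewrite /det3 /=; ring.
by rewrite addr_ge0 // mulr_ge0 ?sqr_ge0 // subr_ge0.
Qed.

(** Right of the middle vertex [b] the section runs between the sides [b c] and
    [a c]; the constraint of the third side follows from the other two. *)
Lemma measure_right_section a b c (x : R) : det3 a b c != 0 ->
  a.1 <= b.1 -> b.1 < c.1 -> b.1 <= x <= c.1 ->
  mu (xsection (tri a b c) x) =
  (`|det3 a b c| * ((c.1 - x) / ((c.1 - b.1) * (c.1 - a.1))))%:E.
Proof.
move=> d0 ab bc /andP[ax xb].
have ac : a.1 < c.1 by exact: le_lt_trans bc.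
have bc0 : 0 < c.1 - b.1 by rewrite subr_gt0.
have ac0 : 0 < c.1 - a.1 by rewrite subr_gt0.
have bcN := lt0r_neq0 bc0; have acN := lt0r_neq0 ac0.
pose l1 := c.2 - (c.2 - b.2) / (c.1 - b.1) * (c.1 - x).
pose l2 := c.2 - (c.2 - a.2) / (c.1 - a.1) * (c.1 - x).
rewrite -(@measure_strip l1 l2) //; last 2 first.
- by rewrite divr_ge0 ?mulr_ge0 ?subr_ge0 // ltW.
- by rewrite /l1 /l2 /det3; field; rewrite bcN acN.
congr (mu _); apply/seteqP.
have zE y : det3 (x, y) b c = (c.1 - b.1) * (y - l1) by rewrite /det3 /l1 /=; field.
have yE y : det3 a (x, y) c = (c.1 - a.1) * (l2 - y) by rewrite /det3 /l2 /=; field.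
split=> y; rewrite /xsection /= inE.
  by move=> [+ + _]; rewrite zE yE -!mulrA (pmulr_rge0 _ bc0) (pmulr_rge0 _ ac0).
move=> [y1 y2].
have w0 : 0 <= det3 (x, y) b c * det3 a b c by rewrite zE -mulrA pmulr_rge0.
split=> //; first by rewrite yE -mulrA pmulr_rge0.
rewrite -(pmulr_rge0 _ bc0).
rewrite [leRHS](_ : _ = det3 a b c ^+ 2 * (x - b.1) +
   (det3 (x, y) b c * det3 a b c) * (b.1 - a.1)); last by rewrite /det3 /=; ring.
by rewrite addr_ge0 // mulr_ge0 ?sqr_ge0 // subr_ge0.
Qed.

Lemma measurable_affine (A : set R) (f : R -> \bar R) (k l : R) : measurable A ->
  (forall x, A x -> f x = (k * x + l)%:E) -> measurable_fun A f.
Proof.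
move=> mA fE.
apply: (eq_measurable_fun (fun x => (k * x + l)%:E)).
  by move=> x; rewrite inE => /fE.
apply/measurable_EFinP; apply: measurable_funTS; apply: continuous_measurable_fun.
by move=> x; apply: cvgD; [apply: cvgM; [exact: cvg_cst|exact: cvg_id]|exact: cvg_cst].
Qed.

Lemma integral_affine (u v k l : R) (f : R -> \bar R) : u < v ->
  (forall x, u <= x <= v -> f x = (k * x + l)%:E) ->
  (\int[mu]_(x in `[u, v]) f x)%E = ((v - u) * (k * (u + v) / 2 + l))%:E.
Proof.
move=> uv fE.
transitivity (\int[mu]_(x in `[u, v]) (k * x + l)%:E)%E.
  by apply: eq_integral => x; rewrite inE /= in_itv /= => /fE.
have cf (k0 l0 : R) : continuous (fun x : R => k0 * x + l0).
  by move=> x; apply: cvgD; [apply: cvgM; [exact: cvg_cst|exact: cvg_id]|exact: cvg_cst].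
pose F (x : R) := k / 2 * (x * x) + l * x.
have dF (x : R) : is_derive x 1 F (k * x + l).
  rewrite /F; apply: is_derive_eq.
  by rewrite /GRing.scale /=; field.
have cF : continuous F.
  by move=> x; apply: differentiable_continuous; apply/derivable1_diffP; exact: ex_derive.
rewrite (@continuous_FTC2 _ _ F) //.
- by rewrite -EFinB /F; congr EFin; field.
- by apply: continuous_subspaceT; exact: cf.
- split; first by move=> x _; exact: ex_derive.
  + by apply: cvg_at_right_filter; exact: cF.
  + by apply: cvg_at_left_filter; exact: cF.
- by move=> x _; rewrite derive1E; exact: derive_val.
Qed.

(** The length of the vertical section is affine on each side of the middle
    vertex and vanishes outside the triangle. A triangle with a vertical side
    has only one of the two pieces. *)
Lemma area_tri_sorted a b c : det3 a b c != 0 -> a.1 <= b.1 -> b.1 <= c.1 ->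
  (mu \x mu)%E (tri a b c) = (`|det3 a b c| / 2)%:E.
Proof.
move=> d0 ab bc.
pose phi x := mu (xsection (tri a b c) x).
have -> : (mu \x mu)%E (tri a b c) = (\int[mu]_(x in `[a.1, c.1]) phi x)%E.
  rewrite /product_measure1 [RHS]integral_mkcond; apply: eq_integral => x _ /=.
  rewrite patchE; case: ifPn => //; rewrite notin_setE /= in_itv /= => xac.
  rewrite (_ : xsection _ _ = set0) ?measure0 //.
  apply/seteqP; split=> // y; rewrite /xsection /= inE => xy; apply: xac.
  rewrite (tri_leftmost d0 _ _ _ xy) ?(tri_rightmost d0 _ _ _ xy) //; exact: le_trans bc.
pose k1 := `|det3 a b c| / ((b.1 - a.1) * (c.1 - a.1)).
pose k2 := `|det3 a b c| / ((c.1 - b.1) * (c.1 - a.1)).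
have left x : a.1 < b.1 -> a.1 <= x <= b.1 -> phi x = (k1 * x + (- (k1 * a.1)))%:E.
  move=> ab' xab; rewrite /phi measure_left_section //; congr EFin.
  by rewrite /k1; ring.
have right x : b.1 < c.1 -> b.1 <= x <= c.1 -> phi x = (- k2 * x + k2 * c.1)%:E.
  move=> bc' xbc; rewrite /phi measure_right_section //; congr EFin.
  by rewrite /k2; ring.
move: (ab) (bc); rewrite !le_eqVlt => /orP[/eqP e|ab'] /orP[/eqP e'|bc'].
- by move: d0; rewrite /det3 -e' -e !subrr mul0r mulr0 subrr eqxx.
- rewrite e (integral_affine bc' (fun x => right x bc')).
  congr EFin; rewrite /k2 e; field.
  by rewrite subr_eq0 gt_eqF.
- rewrite -e' (integral_affine ab' (fun x => left x ab')).
  congr EFin; rewrite /k1 -e'; field.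
  by rewrite subr_eq0 gt_eqF.
have -> : `[a.1, c.1]%classic = `[a.1, b.1]%classic `|` `]b.1, c.1]%classic.
  by rewrite -itv_bndbnd_setU // bnd_simp.
have right' x : `[b.1, c.1]%classic x -> phi x = (- k2 * x + k2 * c.1)%:E.
  by rewrite /= in_itv /=; apply: right.
have mright : measurable_fun (`]b.1, c.1]%classic : set (measurableTypeR R)) phi.
  apply: (@measurable_affine _ _ (- k2) (k2 * c.1)) => // x.
  by move=> xb; apply: right'; apply: subset_itv_oc_cc xb.
rewrite ge0_integral_setU //; first last.
- rewrite disj_set2E; apply/eqP/seteqP; split=> // x [] /=; rewrite !in_itv /=.
  by move=> /andP[_ xb] /andP[]; rewrite ltNge xb.
- apply/measurable_funU => //; split=> //.
  apply: (@measurable_affine _ _ k1 (- (k1 * a.1))) => // x.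
  by rewrite /= in_itv; exact: left.
rewrite integral_itv_obnd_cbnd // (integral_affine ab' (fun x => left x ab')).
rewrite (integral_affine bc' (fun x => right x bc')).
rewrite -EFinD; congr EFin; rewrite /k1 /k2; field.
by rewrite !subr_eq0 !gt_eqF //; exact: lt_trans bc'.
Qed.

Lemma tri_rot a b c : tri b c a = tri a b c.
Proof.
have [e1 e2 e3] : [/\ forall z, det3 z c a = det3 a z c,
    forall z, det3 b z a = det3 a b z & forall z, det3 b c z = det3 z b c].
  by split=> z; rewrite /det3; ring.
by apply/seteqP; split=> z; rewrite /tri /= (e1 z) (e2 z) (e3 z) (det3_rot a b c) => -[].
Qed.

Lemma det3_swap a b c : det3 b a c = - det3 a b c.
Proof. by rewrite /det3; ring. Qed.

Lemma tri_swap a b c : tri b a c = tri a b c.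
Proof.
have sw x y z : det3 x y z * - det3 a b c = det3 y x z * det3 a b c.
  by rewrite mulrN -mulNr -det3_swap.
by apply/seteqP; split=> z; rewrite /tri /= (det3_swap a b c) !sw => -[].
Qed.

Lemma area_tri a b c : det3 a b c != 0 ->
  (mu \x mu)%E (tri a b c) = (`|det3 a b c| / 2)%:E.
Proof.
pose area_formula x y z := det3 x y z != 0 ->
  (mu \x mu)%E (tri x y z) = (`|det3 x y z| / 2)%:E.
have rot x y z : area_formula y z x -> area_formula x y z.
  by rewrite /area_formula tri_rot det3_rot.
have swap x y z : area_formula y x z -> area_formula x y z.
  by rewrite /area_formula tri_swap det3_swap oppr_eq0 normrN.
have sorted x y z : x.1 <= y.1 -> y.1 <= z.1 -> area_formula x y z.
  by move=> xy yz d0; exact: area_tri_sorted.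
rewrite -/(area_formula a b c).
have [ab|/ltW ba] := leP a.1 b.1; have [bc|/ltW cb] := leP b.1 c.1;
  have [ac|/ltW ca] := leP a.1 c.1.
- exact: sorted.
- exact: sorted.
- exact/(swap a b c)/(rot b a c)/sorted.
- exact/(rot a b c)/(rot b c a)/sorted.
- exact/(swap a b c)/sorted.
- exact/(rot a b c)/sorted.
- exact: sorted (le_trans ac cb) (le_trans ba ac).
- exact/(swap a b c)/(rot b a c)/(rot a c b)/sorted.
Qed.

End Area.

(** * Parity in a dense triangulation *)
Lemma odd_intD x y : odd_int (x + y) = odd_int x (+) odd_int y.
Proof. rewrite /odd_int; lia. Qed.

Lemma odd_intN x : odd_int (- x) = odd_int x.
Proof. by rewrite /odd_int abszN. Qed.

Lemma odd_intM x y : odd_int (x * y) = odd_int x && odd_int y.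
Proof. by rewrite /odd_int abszM oddM. Qed.

Lemma even_intP x : ~~ odd_int x -> exists k, x = k + k.
Proof. rewrite /odd_int => h; exists (x %/ 2)%Z; lia. Qed.

Lemma segment_typeC tau p q : segment_type tau p q = segment_type tau q p.
Proof.
by rewrite /segment_type -(odd_intN (p.1 - q.1)) -(odd_intN (p.2 - q.2)) !opprB.
Qed.

Lemma has_typeE tau p q : has_type tau [fset p; q]%fset <-> segment_type tau p q.
Proof.
split=> [[p' [q' [e t]]]|t]; last by exists p, q.
have /fsetP/(_ p) := e; have /fsetP/(_ q) := e.
have /fsetP/(_ p') := e; have /fsetP/(_ q') := e.
rewrite !inE !eqxx ?orbT /= => + + /esym + /esym.
move=> /orP[]/eqP h1 /orP[]/eqP h2 /orP[]/eqP h3 /orP[]/eqP h4; move: t; subst => //;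
  by rewrite segment_typeC.
Qed.

(** The vector [p - q] is nonzero modulo 2, that is, [p q] has one of the three
    types. *)
Definition odd_difference (p q : lattice_point) :=
  odd_int (p.1 - q.1) || odd_int (p.2 - q.2).

(** The three edge vectors sum to zero and are nonzero modulo 2, so no two of them
    agree modulo 2: they realize each of the three types once. *)
Lemma one_edge_per_type (a b c : lattice_point) tau :
  odd_difference a b -> odd_difference b c -> odd_difference c a ->
  exists e0, forall e,
    (e \in edges_of [fset a; b; c]%fset) && `[< has_type tau e >] = (e == e0).
Proof.
move=> ab bc ca.
have neq x y : odd_difference x y -> x != y.
  by rewrite /odd_difference; apply: contraTneq => ->; rewrite !subrr.
have [nab nbc nca] := And3 (neq _ _ ab) (neq _ _ bc) (neq _ _ ca).
have sw x y : [fset x; y]%fset = [fset y; x]%fset :> simplex by exact: fsetUC.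
have edgeE e : e \in edges_of [fset a; b; c]%fset =
    [|| e == [fset a; b], e == [fset b; c] | e == [fset c; a]]%fset.
  apply/idP/idP => [/edges_ofP[p [q [pq]]]|].
    rewrite !inE -!orbA => /or3P[]/eqP pE /or3P[]/eqP qE ->; move: pq;
      rewrite pE qE ?eqxx // => _;
      by rewrite ?(sw b a) ?(sw a c) ?(sw c b) ?eqxx ?orbT.
  by case/or3P => /eqP->; apply/edges_ofP; [exists a, b|exists b, c|exists c, a];
    split; rewrite // !inE eqxx ?orbT.
have typeE p q : `[< has_type tau [fset p; q]%fset >] = segment_type tau p q.
  by apply/asboolP/idP => /has_typeE.
have [one some] :
    (segment_type tau a b -> ~~ segment_type tau b c && ~~ segment_type tau c a) /\
    (~~ segment_type tau a b -> segment_type tau b c (+) segment_type tau c a).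
  move: ab bc ca; rewrite /odd_difference.
  have -> : c.1 - a.1 = - ((a.1 - b.1) + (b.1 - c.1)) by ring.
  have -> : c.2 - a.2 = - ((a.2 - b.2) + (b.2 - c.2)) by ring.
  rewrite /segment_type !(odd_intD, odd_intN).
  move: (odd_int a.1) (odd_int a.2) (odd_int b.1) (odd_int b.2).
  move: (odd_int c.1) (odd_int c.2).
  by case: tau {typeE} => -[] [] [] [] [] [].
(* An edge [x y] of type [tau] is the only one as soon as the edges different from
   it do not have that type. *)
have pick x y :
    [fset x; y]%fset \in [:: [fset a; b]%fset; [fset b; c]%fset; [fset c; a]%fset] ->
    segment_type tau x y ->
    ([fset x; y]%fset != [fset a; b]%fset -> ~~ segment_type tau a b) ->
    ([fset x; y]%fset != [fset b; c]%fset -> ~~ segment_type tau b c) ->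
    ([fset x; y]%fset != [fset c; a]%fset -> ~~ segment_type tau c a) ->
    forall e, (e \in edges_of [fset a; b; c]%fset) && `[< has_type tau e >] =
      (e == [fset x; y]%fset).
  rewrite !inE => xyE xyt h1 h2 h3 e; rewrite edgeE.
  apply/andP/eqP => [[]|->]; last by rewrite typeE.
  case/or3P => /eqP->; rewrite typeE => t; apply/esym/eqP.
  - by apply: contraTT t => /h1.
  - by apply: contraTT t => /h2.
  - by apply: contraTT t => /h3.
have [tab|tab] := boolP (segment_type tau a b).
  have /andP[nb nc] := one tab; exists [fset a; b]%fset.
  apply: pick => //; first by rewrite !inE eqxx.
  by rewrite eqxx.
have [tbc|tbc] := boolP (segment_type tau b c).
  exists [fset b; c]%fset; apply: pick => //; rewrite ?inE ?eqxx ?orbT //.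
  by move=> _; have := some tab; rewrite tbc.
exists [fset c; a]%fset; apply: pick => //; rewrite ?inE ?eqxx ?orbT //.
by have := some tab; rewrite (negbTE tbc).
Qed.

(** Two distinct nonzero vectors modulo 2 are independent. *)
Lemma odd_det (a b c : lattice_point) :
  odd_difference a b -> odd_difference b c -> odd_difference c a ->
  odd_int (det3 a b c).
Proof.
rewrite /odd_difference /det3 !(odd_intD, odd_intN, odd_intM).
move: (odd_int a.1) (odd_int a.2) (odd_int b.1) (odd_int b.2).
move: (odd_int c.1) (odd_int c.2).
by move=> [] [] [] [] [] [].
Qed.

Section DenseTriangulation.
Context {R : realType}.
Variables (P : set (R * R)) (D : {fset simplex}).
Hypothesis hD : triangulation P D.
Hypothesis hdense : dense_triangulation P D.
Local Notation pl := (@plane_of R).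

(** Otherwise the midpoint [m] of [p q] is a lattice point of the polygon, hence
    by density a vertex of some triangle [U]; being a vertex of [U], it belongs to
    the common face of [T] and [U], so it is a vertex of [T] on the line [p q]
    distinct from [p] and [q]. *)
Lemma dense_odd_difference T p q : T \in D -> p \in T -> q \in T -> p != q ->
  odd_difference p q.
Proof.
move=> TD pT qT pq; apply: contraT; rewrite negb_or.
move=> /andP[/even_intP[k kE] /even_intP[l lE]].
have [Tri PE Dface] := hD.
have [c TE c0] := third_vertex (Tri T TD) pq pT qT.
pose m : lattice_point := (q.1 + k, q.2 + l).
have mE : pl m = midpoint (pl p) (pl q).
  have -> : p = (q.1 + k + k, q.2 + l + l).
    by rewrite [LHS]surjective_pairing -!addrA -kE -lE !(addrC _ (_ - _)) !subrK.
  by rewrite /midpoint /mix /plane_of /= !intrD; congr pair; field.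
have mT : lattice_hull T (pl m).
  rewrite mE; apply: hull_convex; last lra; exact: lattice_hull_vertex.
have : m \in vertices D by apply/hdense/(triangle_hull_sub hD TD).
move=> /bigfcupP[U /andP[UD _] mU].
have [F [FT FU TUF]] := Dface T U TD UD.
have Fm : lattice_hull F (pl m) by rewrite -TUF; split=> //; exact: lattice_hull_vertex.
have mF : m \in F.
  have /fset0Pn[a] : (U `\ m)%fset != fset0.
    rewrite -cardfs_gt0; have := cardfsD1 m U; have [-> _] := Tri U UD.
    by rewrite mU add1n => -[<-].
  rewrite !inE => /andP[am aU].
  have ma : m != a by rewrite eq_sym.
  have [b UE b0] := third_vertex (Tri U UD) ma mU aU.
  apply: (@face_vertex _ F a b m (pl m) _ Fm).
    apply: (fsubset_trans FU); rewrite UE; apply/fsubsetP => v.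
    by rewrite !inE -!orbA => /or3P[]->; rewrite ?orbT.
  by rewrite det3_rot det3_plane_neq0.
move/fsubsetP: FT => /(_ m mF); rewrite TE !inE -orbA => /or3P[] /eqP mv.
- case/eqP: pq; rewrite (surjective_pairing p) (surjective_pairing q).
  move: kE lE mv; case: (p) (q) @m {mE mT mU Fm mF} => p1 p2 [q1 q2] /= kE lE [*].
  by congr pair; lia.
- case/eqP: pq; rewrite (surjective_pairing p) (surjective_pairing q).
  move: kE lE mv; case: (p) (q) @m {mE mT mU Fm mF} => p1 p2 [q1 q2] /= kE lE [*].
  by congr pair; lia.
- by move: (det3_plane_neq0 (R := R) c0); rewrite -mv mE det3_midpoint eqxx.
Qed.

Lemma dense_triangle_vertices T : T \in D ->
  exists a b c, [/\ T = [fset a; b; c]%fset, det3 a b c != 0,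
    odd_difference a b, odd_difference b c & odd_difference c a].
Proof.
move=> TD; have [Tri _ _] := hD.
have [a [b [c [TE d0]]]] := triangle_vertices (Tri T TD).
have [aT bT cT] : [/\ a \in T, b \in T & c \in T].
  by rewrite TE; split; rewrite !inE eqxx ?orbT.
have ab : a != b by apply: contraNneq d0 => ->; rewrite det3_aab.
have bc : b != c by apply: contraNneq d0 => ->; rewrite det3_abb.
have ca : c != a by apply: contraNneq d0 => ->; rewrite det3_aba.
by exists a, b, c; split=> //; apply: dense_odd_difference TD _ _ _.
Qed.

Lemma dense_odd_area T : T \in D -> @odd_area R T.
Proof.
move=> TD; have [a [b [c [TE d0 ab bc ca]]]] := dense_triangle_vertices TD.
exists `|det3 a b c|%N; split; first exact: odd_det.
rewrite /normalized_area TE lattice_hull_triangle // area_tri ?det3_plane_neq0 //.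
rewrite det3_plane -EFinM; congr EFin.
by rewrite mulrC divfK ?pnatr_eq0 // -intr_norm natr_absz.
Qed.

End DenseTriangulation.

(** * Double counting of triangles and edges *)
Lemma card_fset_sum (K : choiceType) (A : {fset K}) (B : pred K) :
  (#|` [fset x in A | B x]%fset|)%:Z = \sum_(x <- A) (B x)%:Z.
Proof.
rewrite -natz -sum1_size natr_sum -big_fset_condE big_mkcond /=.
by apply: eq_bigr => x _; case: (B x).
Qed.

(** Three points off a line cannot be pairwise separated by it: the product of the
    three products is a square. *)
Lemma three_signs (F : realDomainType) (x y z : F) :
  x * y < 0 -> y * z < 0 -> x * z < 0 -> False.
Proof.
move=> xy yz xz; have : x * y * (y * z) * (x * z) < 0 by rewrite pmulr_rlt0 // nmulr_rgt0.
by rewrite (_ : _ * _ = (x * y * z) ^+ 2) ?ltNge ?sqr_ge0 //; ring.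
Qed.

Definition color_sign (black : simplex -> bool) (T : simplex) : int :=
  (black T == true)%:Z - (black T == false)%:Z.

Section DoubleCounting.
Context {R : realType}.
Variables (P : set (R * R)) (D : {fset simplex}).
Hypothesis hD : triangulation P D.
Hypothesis hdense : dense_triangulation P D.
Variable black : simplex -> bool.
Hypothesis hblack : folding D black.

Lemma at_most_two_triangles T U V e : T \in D -> U \in D -> V \in D ->
  e \in edges_of T -> e \in edges_of U -> e \in edges_of V -> T <> U ->
  V = T \/ V = U.
Proof.
move=> TD UD VD eT eU eV TU.
have [Tri _ _] := hD.
have /edges_ofP[p [q [pq pT qT eE]]] := eT.
have third W : W \in D -> e \in edges_of W ->
    exists2 c, W = [fset p; q; c]%fset & det3 p q c != 0.
  move=> WD /edges_ofP[p' [q' [_ p'W q'W eE']]].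
  have sub x : x \in e -> x \in W by rewrite eE' !inE => /orP[]/eqP->.
  by apply: (third_vertex (Tri W WD) pq); apply: sub; rewrite eE !inE eqxx ?orbT.
have [c TE c0] := third T TD eT.
have [d UE d0] := third U UD eU.
have [f VE f0] := third V VD eV.
have [->|/eqP VT] := eqVneq V T; first by left.
have [->|/eqP VU] := eqVneq V U; first by right.
have fc := shared_edge_opposite hD VD TD VT VE TE f0 c0.
have cd := shared_edge_opposite hD TD UD TU TE UE c0 d0.
have fd := shared_edge_opposite hD VD UD VU VE UE f0 d0.
by case: (three_signs fc cd fd).
Qed.

Lemma mem_edgesP e : reflect (exists2 T, T \in D & e \in edges_of T) (e \in edges D).
Proof.
apply: (iffP (bigfcupP _ _ _ _)) => [[T /andP[TD _] eT]|[T TD eT]]; first by exists T.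
by exists T => //; rewrite TD.
Qed.

Definition of_type tau e := `[< has_type tau e >].

Lemma one_edge_of_type tau T : T \in D ->
  \sum_(e <- edges D) ((e \in edges_of T) && of_type tau e)%:Z = 1.
Proof.
move=> TD; have [a [b [c [TE d0 ab bc ca]]]] := dense_triangle_vertices hD hdense TD.
have [e0 e0P] := one_edge_per_type tau ab bc ca.
have {}e0P e : (e \in edges_of T) && of_type tau e = (e == e0) by rewrite TE -e0P.
have e0D : e0 \in edges D.
  by apply/mem_edgesP; exists T => //; have := e0P e0; rewrite eqxx => /andP[].
rewrite (big_fsetD1 e0) //= e0P eqxx big_seq big1 ?addr0 // => e.
by rewrite in_fsetD1 e0P => /andP[/negbTE->].
Qed.

Definition boundary_edge (e : simplex) := `[< lattice_hull e `<=` boundary P >].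

(** An edge in the boundary lies in a single triangle, whose color is that of the
    edge; any other edge lies in exactly two triangles, of opposite colors. *)
Lemma signed_triangles_at_edge tau e : e \in edges D ->
  \sum_(T <- D) ((e \in edges_of T) && of_type tau e)%:Z * color_sign black T =
  [&& boundary_edge e, `[< edge_has_color D black true e >] & of_type tau e]%:Z -
  [&& boundary_edge e, `[< edge_has_color D black false e >] & of_type tau e]%:Z.
Proof.
move=> /mem_edgesP[T TD eT].
have [et|et] := boolP (of_type tau e); last first.
  by rewrite !andbF big1 // => U _; rewrite andbF mul0r.
have sum_over (S : {fset simplex}) : (S `<=` D)%fset ->
    (forall U, U \in D -> e \in edges_of U -> U \in S) ->
    (forall U, U \in S -> e \in edges_of U) ->
    \sum_(T <- D) ((e \in edges_of T) && true)%:Z * color_sign black T =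
    \sum_(T <- S) color_sign black T.
  move=> SD DS eS; rewrite -(big_fset_incl _ SD) /= => [|U UD US].
    by rewrite big_seq [RHS]big_seq; apply: eq_bigr => U US; rewrite eS // mul1r.
  by rewrite (contraNF (DS U UD) US) mul0r.
rewrite !andbT.
have [/asboolP eB|/asboolP eB] := boolP (boundary_edge e).
  have uniqT U : U \in D -> e \in edges_of U -> U = T.
    move=> UD eU; apply: contrapT => UT.
    exact: (shared_edge_not_boundary hD UD TD UT eU eT eB).
  rewrite (sum_over [fset T]%fset).
  - rewrite big_seq_fset1 /= /color_sign.
    have colE col : `[< edge_has_color D black col e >] = (black T == col).
      apply/asboolP/eqP => [[U [UD eU <-]]|<-]; first by rewrite (uniqT U).
      by exists T.
    by rewrite !colE.
  - by rewrite fsub1set.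
  - by move=> U UD eU; rewrite inE (uniqT U).
  - by move=> U; rewrite inE => /eqP->.
have [U [UD UT eU]] := inner_edge_shared hD TD eT eB.
rewrite (sum_over [fset T; U]%fset) /=.
- rewrite big_fsetU1 /= ?big_seq_fset1 ?inE; last by apply/eqP => /esym.
  have : black U <> black T.
    apply: hblack => //; split=> //; by exists e.
  by rewrite /color_sign; move: (black U) (black T) => [] [] /eqP.
- by apply/fsubsetP => V; rewrite !inE => /orP[]/eqP->.
- move=> V VD eV; have [->|->] := at_most_two_triangles UD TD VD eU eT eV UT;
    by rewrite !inE eqxx ?orbT.
- by move=> V; rewrite in_fset2 => /orP[]/eqP->.
Qed.

(** Both sides count, with signs, the pairs of a triangle and an edge of type [tau]
    of it: the left side by triangles, the right side by edges. *)
Lemma signed_count_eq tau :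
  (#|` odd_triangles R D black true|)%:Z - (#|` odd_triangles R D black false|)%:Z =
  (#|` typed_boundary_edges P D black true tau|)%:Z -
  (#|` typed_boundary_edges P D black false tau|)%:Z.
Proof.
have oddE col : (#|` odd_triangles R D black col|)%:Z = \sum_(T <- D) (black T == col)%:Z.
  rewrite card_fset_sum big_seq [RHS]big_seq; apply: eq_bigr => T TD.
  have /asboolP -> := dense_odd_area hD hdense TD; by rewrite andbT.
have bdE col : (#|` typed_boundary_edges P D black col tau|)%:Z =
    \sum_(e <- edges D)
      [&& boundary_edge e, `[< edge_has_color D black col e >] & of_type tau e]%:Z.
  rewrite -card_fset_sum; congr (Posz #|` _|).
  by apply/fsetP => e; rewrite /typed_boundary_edges /boundary_edges !inE /= -!andbA.
rewrite !oddE !bdE -!sumrB.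
transitivity (\sum_(T <- D) \sum_(e <- edges D)
   ((e \in edges_of T) && of_type tau e)%:Z * color_sign black T).
  rewrite big_seq [RHS]big_seq; apply: eq_bigr => T TD.
  by rewrite -mulr_suml one_edge_of_type // mul1r.
rewrite exchange_big /= big_seq [RHS]big_seq; apply: eq_bigr => e eD.
exact: signed_triangles_at_edge.
Qed.

End DoubleCounting.

Local Open Scope fset_scope.

Theorem theorem3 (R : realType) (P : set (R * R)) (D : {fset simplex})
    (hP : lattice_polygon P) (hD : triangulation P D)
    (hdense : dense_triangulation P D) (hfold : foldable D)
    (black : simplex -> bool) (hblack : folding D black) (tau : edge_type) :
  signature R D black =
  absdiff #|` typed_boundary_edges P D black true tau|
          #|` typed_boundary_edges P D black false tau|.
Proof. by rewrite /signature /absdiff (signed_count_eq hD hdense hblack tau). Qed.
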